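(* Let $\theta,\varphi\in\mathbb{S}^1$ be two arbitrary external angles, let $\nu:=\nu(\theta)$ be the kneading sequence of $\theta$ and let $x:=\nu_\theta(\varphi)$ be the itinerary of $\varphi$ with respect to $\theta$; assume that $x\in\{0,1\}^{\{1,2,3,\ldots\}}$. Then $\varphi$ is combinatorially biaccessible with respect to $\theta$ if and only if there is a $k\ge2$ that satisfies $$\mathrm{orb}_{\rho_{\nu,x}}(1)\cap\mathrm{orb}_{\rho_{\nu,x}}(k)=\emptyset.$$
   Context: $\mathbb{S}^1=\mathbb{R}/\mathbb{Z}$, $D(\varphi)=2\varphi \bmod 1$. For $\theta,\varphi\in\mathbb{S}^1$ the itinerary $\nu_\theta(\varphi)=\nu_1\nu_2\ldots$ has $\nu_k=0$ if $D^{\circ(k-1)}(\varphi)\in(\frac{1+\theta}{2},\frac{\theta}{2})$, $\nu_k=1$ if $D^{\circ(k-1)}(\varphi)\in(\frac{\theta}{2},\frac{1+\theta}{2})$, $\nu_k=\star$ if $D^{\circ(k-1)}(\varphi)\in\{\frac{\theta}{2},\frac{1+\theta}{2}\}$ (intervals with respect to cyclic order). The kneading sequence is $\nu(\theta)=\nu_\theta(\theta)$. A pair of distinct angles $\langle\alpha,\alpha'\rangle$ separates $\varphi$ from $\varphi'$ if $\varphi,\varphi'$ lie in different components of $\mathbb{S}^1\setminus\{\alpha,\alpha'\}$. For $\varphi\in\mathbb{S}^1$ write $\mathrm{Step}(\varphi)=k$ if $D^{\circ k}(\varphi)=\theta$ and $k\ge0$ is minimal with this property. The pair $\langle\theta/2,(1+\theta)/2\rangle$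 is the critical angle pair. Starting from it, precritical angle pairs are defined by induction on $k$ (the number of iterations required to reach $\theta$): each angle $\alpha$ on the backwards orbit of $\theta$ has a unique angle $\alpha'\ne\alpha$ on the backwards orbit of $\theta$ with $\mathrm{Step}(\alpha)=\mathrm{Step}(\alpha')$ that is not separated from $\alpha$ by precritical angle pairs with lower values of $\mathrm{Step}$, and then $\langle\alpha,\alpha'\rangle$ is a precritical angle pair. An angle $\varphi$ is combinatorially biaccessible with respect to $\theta$ if there is $\varphi'\in\mathbb{S}^1$, $\varphi'\ne\varphi$, such that no precritical angle pair separates $\varphi$ from $\varphi'$. $\rho_{\nu,x}(n)=\min\{k>n:x_k\ne\nu_{k-n}\}$ (value $\infty$ if there is no such $k$), and $\mathrm{orb}_{\rho_{\nu,x}}(k)=\{\rho_{\nu,x}^{\circ i}(k)\}_{i\ge0}$, the orbit ending if the value $\infty$ is reached ($\infty$ is not counted). The function $\rho_{\nu,x}$ is defined for kneading sequences $\nu$ with first entry $1$; the sequence $\overline\star=\nu(0)$ is excluded.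
   Formalization: θ≠0, as the context requires. For periodic θ pairing by minimal Step is ill-defined (θ=1/3: 7/12 has no partner), so precritical pairs are distinct α, α' with D^k(α)=D^k(α')=θ, k not necessarily minimal, unseparated by lower-level pairs; α' need not be unique. *)

(* Defs.v *)
(* Mathematical Components / MathComp-Analysis; R is an arbitrary realType. *)
From mathcomp Require Import all_boot all_order all_algebra.
From mathcomp Require Import boolp classical_sets reals.

Set Implicit Arguments.
Unset Strict Implicit.
Unset Printing Implicit Defensive.

Import Order.TTheory GRing.Theory Num.Theory.

Local Open Scope ring_scope.

(* A point of R/Z is given by its representative in [0, 1[, so that equality
   of angles is Leibniz equality. *)
Definition angle (R : realType) := {x : R | 0 <= x < 1}.

Lemma frac_itv (R : realType) (x : R) : 0 <= x - (Num.floor x)%:~R < 1.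
Proof.
rewrite subr_ge0 floor_le ltrBlDr addrC /=.
by have := floorD1_gt x; rewrite intrD.
Qed.

Definition toS1 (R : realType) (x : R) : angle R :=
  exist _ (x - (Num.floor x)%:~R) (frac_itv x).

Definition D (R : realType) (phi : angle R) : angle R := toS1 (2 * val phi).

(* theta/2 in [0, 1/2[ and (1 + theta)/2 in [1/2, 1[: the two preimages of
   theta under D. *)
Definition half (R : realType) (theta : angle R) : angle R :=
  toS1 (val theta / 2).
Definition half1 (R : realType) (theta : angle R) : angle R :=
  toS1 ((1 + val theta) / 2).

(* x lies in the open arc (a, b) run counterclockwise from a to b; the three
   cases are the positions of the cut at 0 (for a = b the arc is empty, but
   only a <> b is used). *)
Definition arc (R : realType) (a b x : angle R) : bool :=
  [|| val a < val x < val b, val x < val b < val a | val b < val a < val x].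

(* Symbols: Some false is 0, Some true is 1, None is the star.
   Sequences are indexed from 1; the value at index 0 is junk and never read. *)
Definition symbol := option bool.

Definition itinerary (R : realType) (theta phi : angle R) (k : nat) : symbol :=
  let y := iter k.-1 (@D R) phi in
  if arc (half1 theta) (half theta) y then Some false
  else if arc (half theta) (half1 theta) y then Some true
  else None.

Definition kneading (R : realType) (theta : angle R) : nat -> symbol :=
  itinerary theta theta.

(* For a <> b, the components of S^1 minus {a, b} are the arcs (a, b) and
   (b, a); in particular {a, b} does not separate a or b from anything. *)
Definition separates (R : realType) (a b x y : angle R) : bool :=
  arc a b x && arc b a y || arc b a x && arc a b y.

Definition is_step (R : realType) (theta a : angle R) (k : nat) : Prop :=
  iter k (@D R) a = theta /\
  forall j, (j < k)%N -> iter j (@D R) a <> theta.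

(* [precritical_upto theta n a b]: <a, b> is a precritical angle pair that
   needs at most n.+1 iterations to reach theta (n = 0: the critical pair).
   The iteration count is not required to be the first hitting time of theta.
   If theta is not periodic, the two agree (lemma [step_iter] below). If theta
   is periodic, pairing angles by their first hitting times does not work: for
   theta = 1/3 the angles first hitting theta after 2 iterations are 1/12, 7/12
   and 5/6, the pair <1/6, 2/3> separates 7/12 from the two others, and the
   pair of 7/12 is <1/3, 7/12>, where 1/3 = theta has first hitting time 0. *)
Fixpoint precritical_upto (R : realType) (theta : angle R) (n : nat)
    (a b : angle R) : Prop :=
  match n with
  | 0 => (a = half theta /\ b = half1 theta) \/
         (a = half1 theta /\ b = half theta)
  | m.+1 =>
      precritical_upto theta m a b \/
      [/\ a <> b,
          iter m.+2 (@D R) a = theta,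
          iter m.+2 (@D R) b = theta &
          forall c d, precritical_upto theta m c d -> ~~ separates c d a b]
  end.

Definition precritical_pair (R : realType) (theta a b : angle R) : Prop :=
  exists n, precritical_upto theta n a b.

Lemma step_iter (R : realType) (theta a : angle R) (k : nat) :
    (forall n, (0 < n)%N -> iter n (@D R) theta <> theta) ->
  is_step theta a k <-> iter k (@D R) a = theta.
Proof.
move=> aper; split=> [[]//|ka]; split=> // j jk ja.
apply: (aper (k - j)%N); first by rewrite subn_gt0.
by rewrite -{1}ja -iterD subnK // ltnW.
Qed.

Definition comb_biaccessible (R : realType) (theta phi : angle R) : Prop :=
  exists2 phi' : angle R, phi' <> phi &
    forall a b, precritical_pair theta a b -> ~~ separates a b phi phi'.

(* None stands for the value oo. *)
Definition rho (nu x : nat -> symbol) (n : nat) : option nat :=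
  match pselect (exists k, (n < k)%N && (x k != nu (k - n)%N)) with
  | left ex => Some (ex_minn ex)
  | right _ => None
  end.

Definition orb (nu x : nat -> symbol) (k : nat) : set nat :=
  [set m | exists i, iter i (obind (rho nu x)) (Some k) = Some m]%classic.

(* Main.v *)
(* Cut the circle at phi, so that the other angles become points of ]0, 1[. For
   each n there is a precritical pair of level n that is not separated from phi
   by pairs of lower level; let H_n be the open interval it cuts off from phi.
   Two such intervals are nested, the one of higher level being the larger, or
   have disjoint closures, and rho n is the first m > n with H_n contained in
   H_m. Every precritical pair cuts off from phi a part of some H_n, so phi' is
   not separated from phi iff it lies in no H_n; moreover the union of the H_n
   is dense.
   If phi' lies in no H_n, then by density there is an H_k on the side of phi'
   not containing H_1, and the orbits of 1 and k stay on different sides.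
   Conversely, if the orbits of 1 and k are disjoint, all the intervals of one
   orbit lie to the left of those of the other, and the supremum of the right
   ends of the former lies in no H_n. *)
From mathcomp Require Import all_boot all_order all_algebra.
From mathcomp Require Import boolp classical_sets reals.
From mathcomp Require Import lra.
Require Import Defs.

Set Implicit Arguments.
Unset Strict Implicit.
Unset Printing Implicit Defensive.

Import Order.TTheory GRing.Theory Num.Theory.

Local Open Scope ring_scope.

(** * The circle cut open at an angle *)

Section Angles.

Variable R : realType.
Implicit Types o t a b x : angle R.

Lemma val_toS1 (y : R) (z : int) :
  z%:~R <= y < z%:~R + 1 -> val (toS1 y) = y - z%:~R.
Proof. by move=> yz; rewrite /= (@floor_def _ y z) // intrD. Qed.

Lemma val_angle_itv t : 0 <= val t < 1.
Proof. exact: (valP t). Qed.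

Lemma val_D t : val (D t) = if val t < 1/2 then 2 * val t else 2 * val t - 1.
Proof.
have := val_angle_itv t; rewrite /D; case: ifPn => h1 h2.
  by rewrite (@val_toS1 _ 0); lra.
by rewrite (@val_toS1 _ 1); lra.
Qed.

Lemma val_half t : val (half t) = val t / 2.
Proof. by have := val_angle_itv t => h; rewrite (@val_toS1 _ 0); lra. Qed.

Lemma val_half1 t : val (half1 t) = (1 + val t) / 2.
Proof. by have := val_angle_itv t => h; rewrite (@val_toS1 _ 0); lra. Qed.

Lemma half_neq_half1 t : half t <> half1 t.
Proof. by move/(congr1 val); rewrite val_half val_half1; lra. Qed.

Lemma D_half t : D (half t) = t.
Proof.
apply: val_inj; rewrite val_D val_half; have := val_angle_itv t.
by case: ifPn; lra.
Qed.

Lemma D_half1 t : D (half1 t) = t.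
Proof.
apply: val_inj; rewrite val_D val_half1; have := val_angle_itv t.
by case: ifPn; lra.
Qed.

(** The counterclockwise distance from [o] to [t]; it identifies the circle cut at [o] with [0,
    1[. *)
Definition coord o t : R := val (toS1 (val t - val o)).

Definition of_coord o (s : R) : angle R := toS1 (val o + s).

Lemma coordE o t :
  coord o t = if val o <= val t then val t - val o else val t - val o + 1.
Proof.
have := val_angle_itv t; have := val_angle_itv o => h1 h2.
rewrite /coord; case: ifPn => h.
  by rewrite (@val_toS1 _ 0); lra.
by rewrite (@val_toS1 _ (-1)); lra.
Qed.

Lemma coord_itv o t : 0 <= coord o t < 1.
Proof. exact: val_angle_itv. Qed.

Lemma coord_inj o : injective (coord o).
Proof.
move=> t t'; rewrite !coordE => h; apply: val_inj; move: h.
have := val_angle_itv t; have := val_angle_itv t'; have := val_angle_itv o.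
by do 2 case: ifPn; lra.
Qed.

Lemma coord_oo o : coord o o = 0.
Proof. by rewrite coordE lexx subrr. Qed.

Lemma coord_gt0 o t : t <> o -> 0 < coord o t.
Proof.
move=> h; rewrite lt_neqAle eq_sym; case/andP: (coord_itv o t) => -> _.
by rewrite andbT; apply/eqP => h'; apply/h/(@coord_inj o); rewrite h' coord_oo.
Qed.

Lemma of_coordK o (s : R) : 0 <= s < 1 -> coord o (of_coord o s) = s.
Proof.
move=> hs; have := val_angle_itv o => ho; rewrite coordE /of_coord.
have [h|h] := ltP (val o + s) 1.
  by rewrite (@val_toS1 _ 0); [case: ifPn; lra|lra].
by rewrite (@val_toS1 _ 1); [case: ifPn; lra|lra].
Qed.

Lemma coord_D o t : coord (D o) (D t) =
  if coord o t < 1/2 then 2 * coord o t else 2 * coord o t - 1.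
Proof.
rewrite !coordE !val_D.
have := val_angle_itv t; have := val_angle_itv o.
by do 6?case: ifPn; lra.
Qed.

Definition rarc (a b x : R) : bool := [|| a < x < b, x < b < a | b < a < x].

Lemma arc_coord o a b x :
  arc a b x = rarc (coord o a) (coord o b) (coord o x).
Proof.
rewrite /arc /rarc !coordE.
have := val_angle_itv o; have := val_angle_itv a; have := val_angle_itv b.
have := val_angle_itv x.
move: (val o) (val a) (val b) (val x) => vo va vb vx hx hb ha ho.
by apply/idP/idP; do 3 case: ifPn; lra.
Qed.

Lemma separates_coord o a b x y :
    coord o a < coord o b ->
  separates a b x y =
    ((coord o a < coord o x < coord o b) &&
       ((coord o y < coord o a) || (coord o b < coord o y)))
    || ((coord o a < coord o y < coord o b) &&
       ((coord o x < coord o a) || (coord o b < coord o x))).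
Proof.
rewrite /separates !(arc_coord o) /rarc => h.
move: (coord o a) (coord o b) (coord o x) (coord o y) h => va vb vx vy h.
by apply/idP/idP; lra.
Qed.

Lemma separatesC a b x y : separates a b x y = separates b a x y.
Proof. by rewrite /separates orbC. Qed.

Lemma separates_diag a x y : separates a a x y = false.
Proof. by rewrite /separates /arc; apply/negP; lra. Qed.

End Angles.

(** * The intervals cut off from [o]: nesting, density, end points *)

Section Intervals.

Variables (R : realType) (theta : angle R).
Implicit Types o t a b c d : angle R.

(** Equivalently, the itinerary of [o] has no star. It keeps every angle that a positive iterate
    maps to theta away from the cut. *)
Definition free o := forall n, iter n.+1 (@D R) o <> theta.

Lemma free_D o : free o -> free (D o).
Proof. by move=> fo n; rewrite -iterSr; apply: fo. Qed.

Lemma free_iter n o : free o -> free (iter n (@D R) o).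
Proof. by move=> fo m; rewrite -iterD addSn; apply: fo. Qed.

(** The position of theta seen from [D o]. Since [D] doubles coordinates modulo 1, the critical pair
    seen from [o] is at [tau o / 2] and [(tau o + 1) / 2]. *)
Definition tau o : R := coord (D o) theta.

Lemma tau_itv o : free o -> 0 < tau o < 1.
Proof.
move=> fo; rewrite /tau; case/andP: (coord_itv (D o) theta) => _ ->.
by rewrite andbT coord_gt0 // => h; apply: (fo 0%N).
Qed.

(* ]lo n o, hi n o[ is the interval H_(n+1) of the header for phi = o: the
   sequences of the statement are indexed from 1. It is pulled back from D o
   along the branch of D^-1 that follows o; when its closure contains tau o, it
   absorbs the interval cut off by the critical pair. The strictness of the two
   tests matters only if theta is periodic: then theta can be an end of the
   interval, and it has to be absorbed because a star of nu never matches x. *)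
Fixpoint lo (n : nat) o : R :=
  if n is m.+1 then
    if lo m (D o) <= tau o then lo m (D o) / 2 else (lo m (D o) + 1) / 2
  else tau o / 2.

Fixpoint hi (n : nat) o : R :=
  if n is m.+1 then
    if hi m (D o) < tau o then hi m (D o) / 2 else (hi m (D o) + 1) / 2
  else (tau o + 1) / 2.

Lemma lo_hi n o : free o -> (0 < lo n o) && (lo n o < hi n o < 1).
Proof.
elim: n o => [|n IH] o fo; have ht := tau_itv fo => /=; first lra.
by have := IH _ (free_D fo); do 2 case: ifPn; lra.
Qed.

Lemma coord_DE o t : free o -> ~~ (lo 0 o < coord o t < hi 0 o) ->
  (coord o t <= tau o / 2 /\ coord (D o) (D t) = 2 * coord o t) \/
  ((tau o + 1) / 2 <= coord o t /\ coord (D o) (D t) = 2 * coord o t - 1).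
Proof.
move=> fo; have := tau_itv fo => ht /=; rewrite coord_D.
by case: ifPn; lra.
Qed.

Definition nested i j o := lo j o <= lo i o /\ hi i o <= hi j o.
Definition apart i j o := hi i o < lo j o \/ hi j o < lo i o.

Definition mem_closed n o t := lo n o <= coord o t <= hi n o.

(** Pulling two intervals back along the branch of [o] keeps them nested or apart, which reduces to
    [i = 0]. The critical interval is absorbed exactly when the image interval has theta in its
    closure. *)
Lemma nested_or_apart i j o : free o -> (i < j)%N ->
  if mem_closed (j - i.+1) (iter i.+1 (@D R) o) theta
  then nested i j o else apart i j o.
Proof.
elim: i j o => [|i IH] [//|j] o fo.
  move=> _; rewrite subSS subn0 /mem_closed /= -/(tau o).
  have := lo_hi j (free_D fo); have := tau_itv fo.
  by case: ifPn; rewrite /nested /apart /=; do 2 case: ifPn; lra.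
rewrite ltnS subSS iterSr => /(IH _ _ (free_D fo)).
have := lo_hi j (free_D fo); have := lo_hi i (free_D fo); have := tau_itv fo.
by case: ifPn => _; rewrite /nested /apart /=; do 4 case: ifPn; lra.
Qed.

Lemma nested_or_apart_dec i j o : free o -> (i < j)%N ->
  nested i j o \/ apart i j o.
Proof.
by move=> fo /(nested_or_apart fo); case: ifP; [left | right].
Qed.

Lemma mem_closedS n o t : free o -> ~~ mem_closed 0 o t ->
  mem_closed n.+1 o t = mem_closed n (D o) (D t).
Proof.
move=> fo h; have := @coord_DE o t fo; move: h; rewrite /mem_closed /=.
have := lo_hi n (free_D fo); have := tau_itv fo.
move: (coord o t) (coord (D o) (D t)) => s s' ht l h1 h2.
have {}h2 := h2 ltac:(lra).
by apply/idP/idP; do 2 case: ifPn; lra.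
Qed.

(* Hence t enters the closed intervals at the first index where the itineraries
   of o and t differ, a star of t counting as a difference. *)
Lemma mem_closed_iter n o t : free o ->
    (forall i, (i < n)%N -> ~~ mem_closed 0 (iter i (@D R) o) (iter i (@D R) t)) ->
  mem_closed n o t = mem_closed 0 (iter n (@D R) o) (iter n (@D R) t).
Proof.
elim: n o t => [//|n IH] o t fo h.
rewrite mem_closedS // ?(h 0%N) // IH ?iterSr //; first exact: free_D.
by move=> i ilt; have := h i.+1 ilt; rewrite !iterSr.
Qed.

(** While ]p, q[ misses the critical interval, [D] doubles its length, which cannot exceed 1. *)
Lemma long_meets_interval n o (p q : R) : free o -> 0 <= p -> q <= 1 -> p < q ->
    1 <= 2 ^+ n * (q - p) ->
  exists m s, p < s < q /\ lo m o < s < hi m o.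
Proof.
elim: n o p q => [|n IH] o p q fo p0 q1 pq len; have ht := tau_itv fo.
  exists 0%N, (1 / 2); move: len; rewrite expr0 /=; lra.
have [h1|h1] := leP (tau o / 2) p.
  have [h2|h2] := ltP p ((tau o + 1) / 2).
    exists 0%N; have [h3|h3] := leP q ((tau o + 1) / 2).
      by exists ((p + q) / 2) => /=; lra.
    by exists ((p + (tau o + 1) / 2) / 2) => /=; lra.
  have [||||m [s [hs hm]]] := IH (D o) (2 * p - 1) (2 * q - 1) (free_D fo).
  - lra.
  - lra.
  - lra.
  - by move: len; rewrite exprSr; move: (2 ^+ n) => e; lra.
  exists m.+1, ((s + 1) / 2) => /=; split; first lra.
  by do 2 case: ifPn; lra.
have [h2|h2] := leP q (tau o / 2).
  have [||||m [s [hs hm]]] := IH (D o) (2 * p) (2 * q) (free_D fo).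
  - lra.
  - lra.
  - lra.
  - by move: len; rewrite exprSr; move: (2 ^+ n) => e; lra.
  exists m.+1, (s / 2) => /=; split; first lra.
  by have := lo_hi m (free_D fo); do 2 case: ifPn; lra.
exists 0%N; have [h3|h3] := leP q ((tau o + 1) / 2).
  by exists ((tau o / 2 + q) / 2) => /=; lra.
by exists ((tau o + 1 / 2) / 2) => /=; lra.
Qed.

Lemma meets_interval o (p q : R) : free o -> 0 <= p -> q <= 1 -> p < q ->
  exists m s, p < s < q /\ lo m o < s < hi m o.
Proof.
move=> fo p0 q1 pq.
have dpq : 0 < q - p by lra.
have [n hn] : exists n : nat, (q - p)^-1 < n%:R.
  by exists (Num.bound (q - p)^-1); rewrite archi_boundP // invr_ge0 ltW.
apply: (@long_meets_interval n) => //; rewrite -ler_pdivrMr // mul1r.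
apply: (le_trans (ltW hn)); rewrite -natrX ler_nat.
exact/ltnW/ltn_expl.
Qed.

Definition lo_pt n o := of_coord o (lo n o).
Definition hi_pt n o := of_coord o (hi n o).

Lemma coord_lo_pt n o : free o -> coord o (lo_pt n o) = lo n o.
Proof. by move=> fo; have ? := lo_hi n fo; rewrite of_coordK //; lra. Qed.

Lemma coord_hi_pt n o : free o -> coord o (hi_pt n o) = hi n o.
Proof. by move=> fo; have ? := lo_hi n fo; rewrite of_coordK //; lra. Qed.

Lemma D_lo_hi_pt0 o : free o ->
  D (lo_pt 0 o) = theta /\ D (hi_pt 0 o) = theta.
Proof.
move=> fo; have ht := tau_itv fo.
split; apply: (@coord_inj _ (D o)); rewrite coord_D -/(tau o).
  by rewrite coord_lo_pt //= ; case: ifPn; lra.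
by rewrite coord_hi_pt //= ; case: ifPn; lra.
Qed.

Lemma D_lo_hi_ptS n o : free o ->
  D (lo_pt n.+1 o) = lo_pt n (D o) /\ D (hi_pt n.+1 o) = hi_pt n (D o).
Proof.
move=> fo; have ht := tau_itv fo; have h := lo_hi n (free_D fo).
split; apply: (@coord_inj _ (D o)); rewrite coord_D.
  by rewrite !coord_lo_pt //=; [case: ifPn; case: ifPn; lra | exact: free_D].
by rewrite !coord_hi_pt //=; [case: ifPn; case: ifPn; lra | exact: free_D].
Qed.

Lemma iter_lo_hi_pt n o : free o ->
  iter n.+1 (@D R) (lo_pt n o) = theta /\ iter n.+1 (@D R) (hi_pt n o) = theta.
Proof.
elim: n o => [|n IH] o fo; first exact: D_lo_hi_pt0.
by rewrite 2!(iterSr n.+1); have [-> ->] := D_lo_hi_ptS n fo; apply/IH/free_D.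
Qed.

Lemma D_eq_half t : D t = theta -> t = half theta \/ t = half1 theta.
Proof.
move/(congr1 val); rewrite val_D => h.
have := val_angle_itv t; have := val_angle_itv theta.
move: h; case: ifPn => h1 h2 _ _; [left|right]; apply: val_inj.
  by rewrite val_half; lra.
by rewrite val_half1; lra.
Qed.

Lemma coord_preim o t : free o -> D t = theta ->
  coord o t = lo 0 o \/ coord o t = hi 0 o.
Proof.
move=> fo Dt; have := tau_itv fo; have := coord_itv o t.
have := coord_D o t; rewrite Dt -/(tau o) /=; case: ifPn; lra.
Qed.

Lemma iter_neq n o t : free o -> iter n.+1 (@D R) t = theta -> 0 < coord o t.
Proof. by move=> fo ht; apply: coord_gt0 => to; apply: (fo n); rewrite -to. Qed.

(* The two hypotheses put c and d in the gap of o after n cuts, on which D^n is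
   injective up to collapsing the intervals cut off. *)
Lemma preim_pair_covered n o c d : free o ->
    (forall j, (j < n)%N -> ~~ (lo j o < coord o c < hi j o)) ->
    (forall j, (j < n)%N -> ~~ (lo j o < coord o d < hi j o)) ->
    iter n.+1 (@D R) c = theta -> iter n.+1 (@D R) d = theta ->
    coord o c < coord o d ->
  exists2 j, (j <= n)%N & lo j o <= coord o c /\ coord o d <= hi j o.
Proof.
elim: n o c d => [|n IH] o c d fo hc hd tc td cd.
  exists 0%N => //; have := coord_preim fo tc; have := coord_preim fo td.
  by have := lo_hi 0 fo; lra.
have ht := tau_itv fo.
have Dc := coord_DE fo (hc 0%N isT); have Dd := coord_DE fo (hd 0%N isT).
have out t : (forall j, (j < n.+1)%N -> ~~ (lo j o < coord o t < hi j o)) ->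
    forall j, (j < n)%N -> ~~ (lo j (D o) < coord (D o) (D t) < hi j (D o)).
  move=> h j jn; have := h j.+1 jn; have := coord_DE fo (h 0%N isT) => /=.
  by have := lo_hi j (free_D fo); do 2 case: ifPn; lra.
have [Dcd|Dcd] := ltP (coord (D o) (D c)) (coord (D o) (D d)).
  have [|||||j jn hj] := IH _ (D c) (D d) (free_D fo); rewrite -?iterSr //.
  - exact: out.
  - exact: out.
  exists j.+1 => //=; move: Dc Dd; have := lo_hi j (free_D fo).
  by do 2 case: ifPn; lra.
(* The order of [c] and [d] is lost only if they are the two ends of the critical interval, both
   mapped to theta. *)
by exists 0%N => //=; lra.
Qed.

End Intervals.

(** * Precritical pairs compared with the intervals *)

Section PrecriticalPairs.

Variables (R : realType) (theta : angle R).
Implicit Types o t a b c d : angle R.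

Lemma precritical_upto_le n m a b : (n <= m)%N ->
  precritical_upto theta n a b -> precritical_upto theta m a b.
Proof.
move=> nm ab; rewrite -(subnKC nm); elim: (m - n)%N => [|k IH].
  by rewrite addn0.
by rewrite addnS; left.
Qed.

Lemma precritical_upto_sym n a b :
  precritical_upto theta n a b -> precritical_upto theta n b a.
Proof.
elim: n a b => [|n IH] a b /=; first by case=> -[? ?]; [right | left].
case=> [/IH ba|[ab ta tb nsep]]; first by left.
right; split=> //.
  exact: nesym.
move=> c d /nsep; apply: contra => /orP[] /andP[h h']; apply/orP.
  by right; rewrite h h'.
by left; rewrite h h'.
Qed.

Lemma precritical_uptoP n a b : precritical_upto theta n a b ->
  a <> b /\
  exists m, iter m.+1 (@D R) a = theta /\ iter m.+1 (@D R) b = theta.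
Proof.
elim: n a b => [|n IH] a b /=.
  have neq := @half_neq_half1 R theta.
  by case=> -[-> ->]; (split; [exact: neq || exact: nesym |]);
    exists 0%N; rewrite /= D_half D_half1.
by case=> [/IH//|[ab ta tb _]]; split=> //; exists n.+1.
Qed.

(** The two claims feed each other: a new pair is caught because the ends of earlier intervals are
    pairs that do not separate it; the ends of the new interval form a pair because earlier pairs
    are caught in intervals nested in it or apart from it. *)
Lemma precritical_covered n o : free theta o ->
  (forall a b, precritical_upto theta n a b -> coord o a < coord o b ->
     exists2 j, (j <= n)%N &
       lo theta j o <= coord o a /\ coord o b <= hi theta j o) /\
  precritical_upto theta n (lo_pt theta n o) (hi_pt theta n o).
Proof.
move=> fo; elim/ltn_ind: n => -[_|n IH].
  have [Dlo Dhi] := D_lo_hi_pt0 fo; split=> [a b ab lt_ab|].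
    have [_ [_ _]] := precritical_uptoP ab.
    have [Da Db] : D a = theta /\ D b = theta.
      by case: ab => -[-> ->]; rewrite D_half D_half1.
    move: lt_ab; have := coord_preim fo Da; have := coord_preim fo Db.
    by exists 0%N => //; have := lo_hi 0 fo; lra.
  have neq : lo_pt theta 0 o <> hi_pt theta 0 o.
    by move/(congr1 (coord o)); rewrite coord_lo_pt // coord_hi_pt //;
      have := lo_hi 0 fo; lra.
  have [elo|elo] := D_eq_half Dlo; have [ehi|ehi] := D_eq_half Dhi; move: neq;
    rewrite elo ehi //= => _; by [left | right].
have [cover _] := IH n (ltnSn n).
have pair j : (j <= n)%N ->
    precritical_upto theta n (lo_pt theta j o) (hi_pt theta j o).
  by move=> jn; have [_] := IH j jn; apply: precritical_upto_le.
split=> [a b|].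
  case=> [/cover h /h[j jn hj]|[_ ta tb nsep] lt_ab].
    by exists j => //; apply: leqW.
  have sep j : (j <= n)%N -> ~~ separates (lo_pt theta j o) (hi_pt theta j o) a b.
    by move/pair/nsep.
  (* If one of [a], [b] is inside an earlier interval, the other is in its closure, since the ends
     do not separate them. Otherwise both are in the gap. *)
  have [[j jn hj]|h] := pselect (exists2 j, (j <= n)%N &
    (lo theta j o < coord o a < hi theta j o) ||
    (lo theta j o < coord o b < hi theta j o)).
    exists j; first exact: leqW.
    have lt_j : coord o (lo_pt theta j o) < coord o (hi_pt theta j o).
      by rewrite coord_lo_pt // coord_hi_pt //; have := lo_hi j fo; lra.
    move: (sep j jn) hj lt_ab.
    by rewrite (separates_coord _ _ lt_j) coord_lo_pt // coord_hi_pt //; lra.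
  apply: preim_pair_covered => // j jn; apply/negP => hj; apply: h; exists j => //.
    by rewrite hj.
  by rewrite hj orbT.
have [tlo thi] := iter_lo_hi_pt n.+1 fo.
right; split=> //.
  by move/(congr1 (coord o)); rewrite coord_lo_pt // coord_hi_pt //;
    have := lo_hi n.+1 fo; lra.
have main c d : precritical_upto theta n c d -> coord o c < coord o d ->
    ~~ separates c d (lo_pt theta n.+1 o) (hi_pt theta n.+1 o).
  move=> cd lt_cd; have [j jn hj] := cover c d cd lt_cd.
  rewrite (separates_coord _ _ lt_cd) coord_lo_pt // coord_hi_pt //.
  have := lo_hi j fo; have := lo_hi n.+1 fo; move: hj lt_cd.
  have := @nested_or_apart_dec R theta j n.+1 o fo jn; rewrite /nested /apart.
  move: (lo _ j _) (hi _ j _) (lo _ n.+1 _) (hi _ n.+1 _).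
  by move: (coord o c) (coord o d) => *; lra.
move=> c d cd; case: (ltgtP (coord o c) (coord o d)) => [|lt_dc|/coord_inj eq_cd].
- exact: main.
- by rewrite separatesC; apply: main => //; apply: precritical_upto_sym.
- by rewrite eq_cd separates_diag.
Qed.

Lemma not_separated_iff o t : free theta o ->
  (forall a b, precritical_pair theta a b -> ~~ separates a b o t) <->
  (forall j, ~~ (lo theta j o < coord o t < hi theta j o)).
Proof.
move=> fo; split=> [nsep j|out].
  have [_ pair] := precritical_covered j fo.
  have := nsep _ _ (ex_intro _ j pair).
  have lt_j : coord o (lo_pt theta j o) < coord o (hi_pt theta j o).
    by rewrite coord_lo_pt // coord_hi_pt //; have := lo_hi j fo; lra.
  rewrite (separates_coord _ _ lt_j) coord_lo_pt // coord_hi_pt // coord_oo.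
  by have := lo_hi j fo; lra.
have main n a b : precritical_upto theta n a b -> coord o a < coord o b ->
    ~~ separates a b o t.
  move=> ab lt_ab; have [cover _] := precritical_covered n fo.
  have [j _] := cover _ _ ab lt_ab.
  have [_ [m [ta tb]]] := precritical_uptoP ab.
  have := iter_neq fo ta; have := iter_neq fo tb; have := out j.
  rewrite (separates_coord _ _ lt_ab) coord_oo; move: lt_ab.
  by move: (coord o a) (coord o b) (coord o t) => *; lra.
move=> a b [n ab].
case: (ltgtP (coord o a) (coord o b)) => [|lt_ba|/coord_inj eq_ab].
- exact: main ab.
- by rewrite separatesC; apply: main lt_ba; apply: precritical_upto_sym ab.
- by rewrite eq_ab separates_diag.
Qed.

(** The critical interval is the component that does not contain [o]. It is taken closed because at
    its ends [t] has a star and [o] has none. *)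
Lemma itinerary1_neq o t : free theta o ->
  (itinerary theta o 1 != itinerary theta t 1) = mem_closed theta 0 o t.
Proof.
move=> fo; rewrite /itinerary /= !(arc_coord o) coord_oo /mem_closed /rarc.
have := coord_preim fo (D_half theta); have := coord_preim fo (D_half1 theta).
have : coord o (half theta) != coord o (half1 theta).
  by apply/eqP => /coord_inj; apply: half_neq_half1.
have := lo_hi 0 fo; have := coord_itv o t.
move: (coord o (half theta)) (coord o (half1 theta)) (coord o t).
move: (lo theta 0 o) (hi theta 0 o).
move=> l u h h1 s hs hl hh e1 e2.
do ?case: ifPn => ?; apply/esym; rewrite ?eqxx /=; lra.
Qed.

End PrecriticalPairs.

(** * Orbits of [rho] as chains of growing intervals *)

Section Rho.

Variables (R : realType) (theta o : angle R).
Hypothesis fo : free theta o.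

Local Notation lo j := (lo theta j o).
Local Notation hi j := (hi theta j o).
Local Notation rho := (rho (kneading theta) (itinerary theta o)).
Local Notation orb := (orb (kneading theta) (itinerary theta o)).

(** The first mismatch between the itineraries of [D^(i+1) o] and theta occurs when a closed
    interval of [D^(i+1) o] first contains theta; by [nested_or_apart] the corresponding interval of
    [o] is the first to absorb that of index [i]. *)
Lemma rhoP i :
  match rho i.+1 with
  | Some m => exists2 j, m = j.+1 & [/\ (i < j)%N, nested theta i j o &
                forall l, (i < l < j)%N -> apart theta i l o]
  | None => forall l, (i < l)%N -> apart theta i l o
  end.
Proof.
pose p := iter i.+1 (@D R) o; have fp : free theta p by apply: free_iter.
(* Entry i+d+2 of x is compared with entry d+1 of nu; these are the first symbols of [D^d p] and
   [D^d theta]. *)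
have mismatchE d : (itinerary theta o (i.+1 + d).+1 !=
      kneading theta ((i.+1 + d).+1 - i.+1)) =
    mem_closed theta 0 (iter d (@D R) p) (iter d (@D R) theta).
  rewrite -addnS addKn -itinerary1_neq; last exact: free_iter.
  by rewrite addnS (addnC i.+1) /p -iterD.
have first_mismatch d :
    (forall e, (e < d)%N ->
       ~~ mem_closed theta 0 (iter e (@D R) p) (iter e (@D R) theta)) ->
    if mem_closed theta 0 (iter d (@D R) p) (iter d (@D R) theta)
    then nested theta i (i.+1 + d) o else apart theta i (i.+1 + d) o.
  move=> h; rewrite -mem_closed_iter //.
  have := @nested_or_apart R theta i (i.+1 + d) o fo (leq_addr _ _).
  by rewrite addKn.
rewrite /Defs.rho; case: pselect => [ex|nex].
  case: ex_minnP => m /andP[im mm] min; exists m.-1; first by rewrite (ltn_predK im).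
  have below e : (i.+1 + e < m.-1)%N ->
      ~~ mem_closed theta 0 (iter e (@D R) p) (iter e (@D R) theta).
    move=> em; rewrite -mismatchE; apply/negP => he.
    have := min (i.+1 + e).+1; rewrite he andbT ltnS leq_addr => /(_ isT).
    by rewrite leqNgt -(ltn_predK im) ltnS em.
  have im' : (i < m.-1)%N by rewrite -ltnS (ltn_predK im).
  have em : m.-1 = (i.+1 + (m.-1 - i.+1))%N by rewrite subnKC.
  split=> //.
    have := first_mismatch (m.-1 - i.+1)%N; rewrite -mismatchE -em.
    rewrite (ltn_predK im) mm; apply=> e em'; apply: below.
    by rewrite [X in (_ < X)%N]em ltn_add2l.
  move=> l /andP[il lm]; have el : l = (i.+1 + (l - i.+1))%N by rewrite subnKC.
  have small e : (e <= l - i.+1)%N -> (i.+1 + e < m.-1)%N.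
    by move=> he; apply: leq_ltn_trans lm; rewrite el leq_add2l.
  have := first_mismatch _ (fun e he => below e (small e (ltnW he))).
  by rewrite (negbTE (below _ (small _ (leqnn _)))) -el.
have none e : ~~ mem_closed theta 0 (iter e (@D R) p) (iter e (@D R) theta).
  rewrite -mismatchE; apply/negP => he; apply: nex; exists (i.+1 + e).+1.
  by rewrite he andbT ltnS leq_addr.
move=> l il; have el : l = (i.+1 + (l - i.+1))%N by rewrite subnKC.
have := first_mismatch (l - i.+1)%N (fun e _ => none e).
by rewrite (negbTE (none _)) -el.
Qed.

Lemma orb_refl k : orb k k.
Proof. by exists 0%N. Qed.

Lemma orb_rho k m m' : orb k m -> rho m = Some m' -> orb k m'.
Proof. by case=> i ei em; exists i.+1; rewrite iterS ei. Qed.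

Lemma orb_nested k m : orb k.+1 m ->
  exists2 j, m = j.+1 & lo j <= lo k /\ hi k <= hi j.
Proof.
case=> i; elim: i m => [m [<-]|i IH m]; first by exists k.
rewrite iterS; case E: (iter i _ _) => [m0|//] /= em0.
have [j0 ej0 hj0] := IH _ E; have := rhoP j0; rewrite -ej0 em0.
by case=> j -> [_ [h1 h2] _]; exists j => //; lra.
Qed.

(** If interval [j] contained interval [i], the successor [m] of [i] would come no later than [j],
    and not at [j] by disjointness. By induction intervals [m] and [j] are apart, yet both contain
    interval [i]. *)
Lemma disjoint_orb_apart k k' i j : (orb k `&` orb k')%classic = set0 ->
  orb k i.+1 -> orb k' j.+1 -> (i < j)%N -> apart theta i j o.
Proof.
move=> dis; move e: (j - i)%N => n.
elim/ltn_ind: n i e => n IH i e ki kj ij.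
have [nes|//] := nested_or_apart_dec fo ij.
have := rhoP i; case em: (rho i.+1) => [m'|]; last by apply.
case=> m em' [im nes' ap]; rewrite {}em' in em; have km := orb_rho ki em.
have [mj|jm|mj] := ltngtP m j; last first.
- by have : (orb k `&` orb k')%classic j.+1 by [split=> //; rewrite -mj]; rewrite dis.
- by apply: ap; rewrite ij.
have := IH (j - m)%N _ m erefl km kj mj; rewrite -e ltn_sub2l // => /(_ isT).
have := lo_hi i fo; move: nes nes'; rewrite /nested /apart; lra.
Qed.

Lemma disjoint_orb_escape i0 j0 :
    (orb i0.+1 `&` orb j0.+1)%classic = set0 -> hi i0 < lo j0 ->
  exists2 s, 0 < s < 1 & forall m, ~~ (lo m < s < hi m).
Proof.
move=> dis h0; pose E := [set hi i | i in [set i | orb i0.+1 i.+1]]%classic.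
have Ei0 : E (hi i0) by exists i0 => //; exact: orb_refl.
(* Each interval of the orbit contains interval [i0] and is apart from interval [j0], so it stays to
   the left of the latter. *)
have bound i : orb i0.+1 i.+1 -> hi i < lo j0.
  move=> ki; have [_ [<-] hi_i] := orb_nested ki.
  have : apart theta i j0 o.
    have [ij|ji|ij] := ltngtP i j0.
    - exact: disjoint_orb_apart dis ki (orb_refl _) ij.
    - have : (orb j0.+1 `&` orb i0.+1)%classic = set0 by rewrite setIC.
      move/disjoint_orb_apart => /(_ _ _ (orb_refl _) ki ji).
      by rewrite /apart; lra.
    - have : (orb i0.+1 `&` orb j0.+1)%classic j0.+1.
        by split; [rewrite -ij | exact: orb_refl].
      by rewrite dis.
  have := lo_hi i0 fo; have := lo_hi j0 fo; move: hi_i h0.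
  by rewrite /apart; lra.
have supE : has_sup E.
  by split; [exists (hi i0) | exists (lo j0) => _ [i /bound/ltW ? <-]].
have leE i : orb i0.+1 i.+1 -> hi i <= sup E.
  by move=> ki; apply: sup_upper_bound => //; exists i.
have supE_le : sup E <= lo j0.
  by apply: ge_sup; [exists (hi i0) | move=> _ [i /bound/ltW ? <-]].
exists (sup E).
  by have := leE _ (orb_refl _); have := lo_hi i0 fo; have := lo_hi j0 fo; lra.
move=> m; apply/negP => /andP[lo_m hi_m].
have [_ [i ki <-] lt_i] : exists2 y, E y & lo m < y.
  have [y Ey] := sup_adherent (eps := sup E - lo m) ltac:(lra) supE.
  by rewrite subKr; exists y.
rewrite /= in ki.
(* Interval [i] meets interval [m] but ends before it, so it is nested in it and its successor is at
   most [m]. The successor is not [m], whose right end exceeds the supremum, so it replaces [i],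
   closer to [m]. *)
move e: (m - i)%N => n; elim/ltn_ind: n i ki lt_i e => n IH i ki lt_i e.
have lei := leE i ki; have loi := lo_hi i fo.
have [im|mi|im] := ltngtP i m; last by rewrite im leNgt hi_m in lei.
- have [nes|] := nested_or_apart_dec fo im; last by rewrite /apart; lra.
  have := rhoP i; case em: (rho i.+1) => [m'|]; last first.
    by move/(_ _ im); rewrite /apart; lra.
  case=> i' em' [ii' nes' ap]; rewrite {}em' in em; have ki' := orb_rho ki em.
  have lei' := leE i' ki'.
  have [im'|mi'|im'] := ltngtP i' m.
  + apply: (IH _ _ i' ki' _ erefl); first by rewrite -e ltn_sub2l.
    by apply: lt_le_trans lt_i _; case: nes'.
  + by have := ap m; rewrite im mi' => /(_ isT); rewrite /apart; lra.
  + by rewrite im' leNgt hi_m in lei'.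
- by have := nested_or_apart_dec fo mi; rewrite /nested /apart; lra.
Qed.

Lemma escape_disjoint_orb s : 0 < s < 1 -> (forall m, ~~ (lo m < s < hi m)) ->
  exists2 k, (2 <= k)%N & (orb 1 `&` orb k)%classic = set0.
Proof.
move=> hs esc.
(* An index common to both orbits would give an interval containing intervals 0 and [k], hence also
   [s] between them. *)
have disj k : (hi 0 <= s <= lo k) || (hi k <= s <= lo 0) ->
    (orb 1 `&` orb k.+1)%classic = set0.
  move=> hk; rewrite -subset0 => m [/orb_nested[i -> hi_i]].
  move=> /orb_nested[_ [<-] hi_i'].
  have := esc i; have := lo_hi 0 fo; have := lo_hi k fo; lra.
have far k : (hi 0 <= s <= lo k) || (hi k <= s <= lo 0) -> (2 <= k.+1)%N.
  by case: k => //; have := lo_hi 0 fo; lra.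
suff [k hk] : exists k, (hi 0 <= s <= lo k) || (hi k <= s <= lo 0).
  by exists k.+1; [exact: far | exact: disj].
(* By density some interval meets the side of [s] away from interval 0; as it avoids [s], it lies
   wholly on that side. *)
have [h|h] := leP (hi 0) s.
  have [|||k [r [hr hk]]] := @meets_interval R theta o s 1 fo; try lra.
  by exists k; have := esc k; lra.
have [|||k [r [hr hk]]] := @meets_interval R theta o 0 s fo; try lra.
by exists k; have := esc k; have := esc 0%N; lra.
Qed.

End Rho.

(* theta <> 0 because rho is only defined for kneading sequences with first
   entry 1: nu(0) = *** is excluded. *)
Theorem lemma3p9 (R : realType) (theta phi : angle R)
    (theta_neq0 : theta <> toS1 0)
    (x_nostar : forall k : nat, (1 <= k)%N -> itinerary theta phi k <> None) :
  comb_biaccessible theta phi <->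
  exists2 k : nat, (2 <= k)%N &
    (orb (kneading theta) (itinerary theta phi) 1 `&`
     orb (kneading theta) (itinerary theta phi) k)%classic = set0.
Proof.
clear theta_neq0; have fo : free theta phi.
  (* If [D^(n+1) phi] were theta, [D^n phi] would be on the critical pair and entry n+1 of x would
     be a star. *)
  move=> n tn; apply: (x_nostar n.+1) => //.
  have := val_angle_itv theta; rewrite iterS in tn.
  by have [e|e] := D_eq_half tn; rewrite /itinerary succnK e /arc;
    rewrite val_half val_half1 => ?;
    do 2 (case: ifPn => [h|_]; first by exfalso; clear e tn; lra).
split=> [[phi' neq /(not_separated_iff _ fo) out]|[[//|k] k2 dis]].
  apply: (escape_disjoint_orb fo (s := coord phi phi')) => //.
  by rewrite coord_gt0 //; case/andP: (coord_itv phi phi').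
have [s s01 out] : exists2 s, 0 < s < 1 &
    forall m, ~~ (lo theta m phi < s < hi theta m phi).
  have : apart theta 0 k phi.
    by apply: disjoint_orb_apart dis _ _ _ => //; exact: orb_refl.
  case; first exact: disjoint_orb_escape.
  by apply: disjoint_orb_escape => //; rewrite setIC.
have cs : coord phi (of_coord phi s) = s by rewrite of_coordK //; lra.
exists (of_coord phi s).
  by move=> e; move: cs; rewrite e coord_oo; lra.
by apply/not_separated_iff => // j; rewrite cs.
Qed.
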